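(* Let $N\ge 1$, let $\mathbf{A}$ and $\mathbf{B}$ be the adjacency matrices of two undirected, connected graphs on the node set $\{1,\dots,N\}$, and let $\beta_1,\delta_1,\beta_2,\delta_2>0$ with $\tau_1=\beta_1/\delta_1$, $\tau_2=\beta_2/\delta_2$. Consider the bi-virus system $$\dot{\mathbf{x}}=\beta_1\,\mathrm{diag}(\mathbf{1}-\mathbf{x}-\mathbf{y})\mathbf{A}\mathbf{x}-\delta_1\mathbf{x},\qquad \dot{\mathbf{y}}=\beta_2\,\mathrm{diag}(\mathbf{1}-\mathbf{x}-\mathbf{y})\mathbf{B}\mathbf{y}-\delta_2\mathbf{y}$$ on $D=\{(\mathbf{x},\mathbf{y})\in[0,1]^{2N}:\mathbf{x}+\mathbf{y}\le\mathbf{1}\}$, and let $\mathbf{x}^*,\mathbf{y}^*$ be as defined in the context. Let $B_x=\{(\mathbf{x},\mathbf{y})\in D: \mathbf{x}>\mathbf{0}\}$ and $B_y=\{(\mathbf{x},\mathbf{y})\in D:\mathbf{y}>\mathbf{0}\}$. (i) If $\tau_1\lambda(\mathrm{diag}(\mathbf{1}-\mathbf{y}^* )\mathbf{A})>1$ and $\tau_2\lambda(\mathrm{diag}(\mathbf{1}-\mathbf{x}^* )\mathbf{B})\le 1$, then every trajectory of the system starting from a point of $B_x$ converges to $(\mathbf{x}^*,\mathbf{0})$. (ii) If $\tau_1\lambda(\mathrm{diag}(\mathbf{1}-\mathbf{y}^* )\mathbf{A})\le 1$ and $\tau_2\lambda(\mathrm{diag}(\mathbf{1}-\mathbf{x}^*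 )\mathbf{B})>1$, then every trajectory of the system starting from a point of $B_y$ converges to $(\mathbf{0},\mathbf{y}^* )$.
   Context: $\lambda(\mathbf{M})$ denotes the largest real part of the eigenvalues of a square matrix $\mathbf{M}$. For vectors, $\mathbf{x}\le\mathbf{y}$ means $x_i\le y_i$ for all $i$, and $\mathbf{x}>\mathbf{y}$ means $\mathbf{x}\ge\mathbf{y}$ and $\mathbf{x}\ne\mathbf{y}$; $\mathbf{x}\gg\mathbf{0}$ means all entries are strictly positive. $\mathbf{x}^*$ is the globally attractive fixed point of the single-virus SIS system $\dot{\mathbf{x}}=\beta_1\mathrm{diag}(\mathbf{1}-\mathbf{x})\mathbf{A}\mathbf{x}-\delta_1\mathbf{x}$ on $[0,1]^N$: $\mathbf{x}^*=\mathbf{0}$ if $\tau_1\lambda(\mathbf{A})\le1$, and otherwise $\mathbf{x}^*$ is the unique fixed point of that system in $(0,1)^N$ (it attracts all of $[0,1]^N\setminus\{\mathbf{0}\}$). Likewise $\mathbf{y}^*$ is $\mathbf{0}$ if $\tau_2\lambda(\mathbf{B})\le 1$ and otherwise the unique fixed point in $(0,1)^N$ of $\dot{\mathbf{y}}=\beta_2\mathrm{diag}(\mathbf{1}-\mathbf{y})\mathbf{B}\mathbf{y}-\delta_2\mathbf{y}$. *)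

(* Defs.v *)
From mathcomp Require Import all_boot all_order all_algebra.
From mathcomp Require Import all_classical all_reals all_analysis.
From mathcomp Require Import complex.

Set Implicit Arguments.
Unset Strict Implicit.
Unset Printing Implicit Defensive.

Import Order.TTheory GRing.Theory Num.Theory numFieldNormedType.Exports.
Local Open Scope ring_scope.
Local Open Scope classical_set_scope.

Section Defs.
Variable R : realType.

Definition adjacency_connected (N : nat) (A : 'M[R]_N) : Prop :=
  [/\ (forall i j, A i j = 0 \/ A i j = 1),
      (forall i j, A i j = A j i),
      (forall i, A i i = 0) &
      (forall i j, connect (fun k l => A k l != 0) i j)].

Definition eigenvalues (N : nat) (M : 'M[R]_N) : set R[i] :=
  [set z | root (char_poly (map_mx (fun r : R => Complex r 0) M)) z].

Definition lambda_max (N : nat) (M : 'M[R]_N) : R :=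
  sup [set complex.Re z | z in eigenvalues M].

Definition diagv (N : nat) (v : 'I_N -> R) : 'M[R]_N := diag_mx (\row_i v i).

Definition mxv (N : nat) (M : 'M[R]_N) (v : 'I_N -> R) (i : 'I_N) : R :=
  \sum_j M i j * v j.

Definition sis_field (N : nat) (beta delta : R) (A : 'M[R]_N)
  (x : 'I_N -> R) (i : 'I_N) : R :=
  beta * (1 - x i) * mxv A x i - delta * x i.

(* x* as described in the context: 0 if tau lambda(A) <= 1, otherwise the
   (unique) fixed point of the SIS system in (0,1)^N. *)
Definition sis_attractor (N : nat) (beta delta : R) (A : 'M[R]_N)
  (xs : 'I_N -> R) : Prop :=
  if (beta / delta) * lambda_max A <= 1 then (forall i, xs i = 0)
  else (forall i, 0 < xs i < 1) /\ (forall i, sis_field beta delta A xs i = 0).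

Definition bivirus_fx (N : nat) (beta1 delta1 : R) (A : 'M[R]_N)
  (x y : 'I_N -> R) (i : 'I_N) : R :=
  beta1 * (1 - x i - y i) * mxv A x i - delta1 * x i.
Definition bivirus_fy (N : nat) (beta2 delta2 : R) (B : 'M[R]_N)
  (x y : 'I_N -> R) (i : 'I_N) : R :=
  beta2 * (1 - x i - y i) * mxv B y i - delta2 * y i.

Definition in_D (N : nat) (x y : 'I_N -> R) : Prop :=
  forall i, [/\ 0 <= x i <= 1, 0 <= y i <= 1 & x i + y i <= 1].

Definition vgt0 (N : nat) (v : 'I_N -> R) : Prop :=
  (forall i, 0 <= v i) /\ (exists i, v i != 0).

Definition bivirus_traj (N : nat) (beta1 delta1 beta2 delta2 : R)
  (A B : 'M[R]_N) (x y : R -> 'I_N -> R) (x0 y0 : 'I_N -> R) : Prop :=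
  [/\ x 0 = x0 /\ y 0 = y0,
      (forall i, {within [set t : R | 0 <= t], continuous (fun t => x t i)}),
      (forall i, {within [set t : R | 0 <= t], continuous (fun t => y t i)}),
      (forall (i : 'I_N) (t : R), 0 < t ->
         is_derive t (1 : R) (fun s => x s i) (bivirus_fx beta1 delta1 A (x t) (y t) i)) &
      (forall (i : 'I_N) (t : R), 0 < t ->
         is_derive t (1 : R) (fun s => y s i) (bivirus_fy beta2 delta2 B (x t) (y t) i))].

Definition conv_to (N : nat) (x : R -> 'I_N -> R) (l : 'I_N -> R) : Prop :=
  forall i, (fun t => x t i) @ +oo --> l i.

End Defs.

(* Main.v *)
Require Import Defs.
From mathcomp Require Import all_boot all_order all_algebra.
From mathcomp Require Import all_classical all_reals all_analysis.
From mathcomp Require Import complex ring lra.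
Import Order.TTheory GRing.Theory Num.Theory numFieldNormedType.Exports.
Set Implicit Arguments.
Unset Strict Implicit.
Unset Printing Implicit Defensive.
Local Open Scope ring_scope.
Local Open Scope classical_set_scope.

(** Let p be the liminf of x and q the limsup of y along a trajectory.  A
    fluctuation argument gives tau1 (1-p-q) A p <= p and q <= tau2 (1-p-q) B q,
    with p <= xs and q <= ys; p is positive because virus 1 invades (0, ys).
    Put r = p / xs and w = 1/(1-p-q) - 1/(1-xs).  Stability of (xs, 0) against
    virus 2 gives sum q^2 w <= 0.  As w has the sign of q - (xs - p),
    sum q^2 w >= sum (xs-p)^2 w, and by the symmetry of A the latter is at least
    tau1/2 * sum A_ij xs_i xs_j (f r_i - f r_j) (r_j - r_i) with
    f r = (1-r)^2 / r decreasing on ]0, 1], hence nonnegative.  So r is constant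
    and q = xs - p.  If r < 1, then xs is a subsolution for virus 2, so
    xs <= ys, and virus 1 could not invade (0, ys).  Hence p = xs and q = 0. *)

Section Algebra.
Variables (R : realType) (N : nat).
Implicit Types (A B : 'M[R]_N) (u v p q : 'I_N -> R).

Lemma mxv_sym A u v : (forall i j, A i j = A j i) ->
  \sum_i u i * mxv A v i = \sum_i v i * mxv A u i.
Proof.
move=> symA; rewrite /mxv.
under eq_bigr do rewrite big_distrr /=.
under [RHS]eq_bigr do rewrite big_distrr /=.
rewrite exchange_big /=; apply: eq_bigr => i _; apply: eq_bigr => j _.
by rewrite (symA j i); ring.
Qed.

Lemma le_mxv A u v i : (forall i j, 0 <= A i j) -> (forall j, u j <= v j) ->
  mxv A u i <= mxv A v i.
Proof. by move=> A0 uv; apply: ler_sum => j _; apply: ler_wpM2l. Qed.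

Lemma mxv_ge0 A u i : (forall i j, 0 <= A i j) -> (forall j, 0 <= u j) ->
  0 <= mxv A u i.
Proof. by move=> A0 u0; apply: sumr_ge0 => j _; apply: mulr_ge0. Qed.

Lemma mxvZ A c u i : mxv A (fun j => c * u j) i = c * mxv A u i.
Proof. by rewrite /mxv big_distrr /=; apply: eq_bigr => j _; rewrite mulrCA. Qed.

Lemma mxv_le_shift A u v e i : (forall i j, 0 <= A i j <= 1) -> 0 <= e ->
  (forall j, u j <= v j + e) -> mxv A u i <= mxv A v i + N%:R * e.
Proof.
move=> A01 e0 uv.
have -> : N%:R * e = \sum_(j < N) e by rewrite sumr_const card_ord mulr_natl.
rewrite /mxv -big_split /=; apply: ler_sum => j _.
have /andP[A0 A1] := A01 i j; have := uv j; nra.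
Qed.

Lemma mxv_eq0 A u i j : (forall i j, 0 <= A i j) -> (forall j, 0 <= u j) ->
  mxv A u i <= 0 -> A i j != 0 -> u j = 0.
Proof.
move=> A0 u0 le0 Aij.
have : mxv A u i == 0 by rewrite eq_le le0 mxv_ge0.
rewrite psumr_eq0 => [/allP /(_ j)|k _]; last exact: mulr_ge0.
by rewrite mem_index_enum mulf_eq0 (negbTE Aij) => /(_ isT)/eqP.
Qed.

Lemma connect_ind_rel (T : finType) (e : rel T) (P : T -> Prop) (i j : T) :
  connect e i j -> P i -> (forall k l, P k -> e k l -> P l) -> P j.
Proof.
move=> /connectP[s pth ->] Pi step.
elim: s i Pi pth => //= k s IH i Pi /andP[eik pth].
by apply: IH => //; apply: step eik.
Qed.

Lemma sis_subsolution_le A tau p z :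
  (forall i j, 0 <= A i j) -> 0 < tau ->
  (forall i, 0 < z i) -> (forall i, z i = tau * (1 - z i) * mxv A z i) ->
  (forall i, 0 <= p i) -> (forall i, p i <= tau * (1 - p i) * mxv A p i) ->
  forall i, p i <= z i.
Proof.
move=> A0 tau0 z0 zfix p0 psub i0.
have [i _ imax] := @arg_maxP _ R _ i0 predT (fun i => p i / z i) isT.
set c := p i / z i in imax.
have pc j : p j <= c * z j by rewrite -ler_pdivrMr //; exact: imax.
have [c1|c1] := leP c 1.
  by apply: (le_trans (pc i0)); rewrite ler_piMl // ltW.
have pi : p i = c * z i by rewrite /c divfK // gt_eqF.
have pi0 : 0 < p i by rewrite pi mulr_gt0 // (lt_trans ltr01).
have Ap : mxv A p i <= c * mxv A z i by rewrite -mxvZ; apply: le_mxv.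
have Ap0 : 0 <= mxv A p i by exact: mxv_ge0.
have Az0 : 0 <= mxv A z i by apply: mxv_ge0 => // j; apply: ltW.
have := psub i; have := zfix i; have := z0 i.
move: (mxv A p i) (mxv A z i) Ap Ap0 Az0 => a b Ap a0 b0 zi0 zi pi1.
have h1 : 0 < 1 - p i.
  rewrite ltNge; apply/negP => h.
  suff : tau * (1 - p i) * a <= 0 by lra.
  by apply: mulr_le0_ge0 => //; apply: mulr_ge0_le0; [exact: ltW | exact: h].
have h2 : p i <= tau * (1 - p i) * (c * b).
  apply: le_trans pi1 _; apply: ler_wpM2l Ap; rewrite mulr_ge0 ?ltW//.
have h3 : p i = tau * (1 - z i) * (c * b) by rewrite pi [in LHS]zi; ring.
have b1 : 0 < tau * (c * b).
  have c0 : 0 < c by lra.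
  rewrite mulr_gt0 // mulr_gt0 // lt_def b0 andbT.
  by apply/eqP => h; move: h3; rewrite h !mulr0; lra.
have : tau * (c * b) * (p i - z i) <= 0.
  have -> : tau * (c * b) * (p i - z i) =
     tau * (1 - z i) * (c * b) - tau * (1 - p i) * (c * b) by ring.
  by rewrite -h3; lra.
by rewrite pmulr_rle0 // pi => ?; nra.
Qed.

Lemma sis_subsolution_eq0 A tau p :
  (forall i j, 0 <= A i j) -> 0 < tau ->
  (forall v, tau * \sum_i v i * mxv A v i <= \sum_i v i ^+ 2) ->
  (forall i, 0 <= p i) -> (forall i, p i <= tau * (1 - p i) * mxv A p i) ->
  forall i, p i = 0.
Proof.
move=> A0 tau0 ray p0 psub i.
have h j : p j ^+ 2 + p j ^+ 3 <= tau * (p j * mxv A p j).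
  have := psub j; have := p0 j; have := mxv_ge0 j A0 p0.
  move: (p j) (mxv A p j) => a b b0 a0 h.
  have h1 : a <= tau * b.
    by apply: (le_trans h); have := mulr_ge0 (mulr_ge0 (ltW tau0) b0) a0; lra.
  have : a * a <= a * (tau * (1 - a) * b) by apply: ler_wpM2l.
  have : a * a * a <= a * a * (tau * b) by apply: ler_wpM2l => //; apply: mulr_ge0.
  by nra.
have := ray p; rewrite big_distrr /= => hray.
have : \sum_j (p j ^+ 2 + p j ^+ 3) <= \sum_j p j ^+ 2.
  by apply: le_trans hray; apply: ler_sum => j _; apply: h.
rewrite big_split /= gerDl => h3.
have : \sum_j p j ^+ 3 == 0.
  by rewrite eq_le h3 sumr_ge0 // => j _; rewrite exprn_ge0.
rewrite psumr_eq0 => [/allP /(_ i)|j _]; last by rewrite exprn_ge0.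
by rewrite mem_index_enum => /(_ isT); rewrite expf_eq0 /= => /eqP.
Qed.

Lemma coexistence_rigidity A B tau1 tau2 xs p q :
  (forall i j, 0 <= A i j) -> (forall i j, 0 <= B i j) ->
  (forall i j, A i j = A j i) ->
  (forall i j, connect (fun k l => A k l != 0) i j) ->
  0 < tau1 -> 0 < tau2 ->
  (forall i, 0 < xs i < 1) -> (forall i, xs i = tau1 * (1 - xs i) * mxv A xs i) ->
  (forall v, tau2 * \sum_i v i * mxv B v i <= \sum_i v i ^+ 2 / (1 - xs i)) ->
  (forall i, 0 < p i <= xs i) -> (forall i, 0 <= q i) ->
  (forall i, tau1 * (1 - p i - q i) * mxv A p i <= p i) ->
  (forall i, q i <= tau2 * (1 - p i - q i) * mxv B q i) ->
  (forall i j, p i / xs i = p j / xs j) /\ (forall i, q i = xs i - p i).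
Proof.
move=> A0 B0 symA conA t1 t2 xs01 xsfix ray p0 q0 psup qsub.
pose s i := 1 - p i - q i.
pose r i := p i / xs i.
have xs0 i : 0 < xs i by have /andP[] := xs01 i.
have xs1 i : 0 < 1 - xs i by have /andP[_] := xs01 i; lra.
have pp i : 0 < p i by have /andP[] := p0 i.
have px i : p i <= xs i by have /andP[] := p0 i.
have pE i : p i = r i * xs i by rewrite /r divfK // gt_eqF.
have r0 i : 0 < r i by rewrite /r divr_gt0.
have r1 i : r i <= 1 by rewrite /r ler_pdivrMr // mul1r.
have s0 i : 0 < s i.
  have [qi|qi] := eqVneq (q i) 0.
    by rewrite /s qi; have := px i; have := xs1 i; lra.
  rewrite ltNge; apply/negP => si.
  have := qsub i; rewrite -/(s i) => h.
  have qi0 : 0 < q i by rewrite lt_def qi q0.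
  suff : tau2 * s i * mxv B q i <= 0 by lra.
  by apply: mulr_le0_ge0; [apply: mulr_ge0_le0; [exact: ltW|] | exact: mxv_ge0].
pose w i := (s i)^-1 - (1 - xs i)^-1.
have wE i : w i = (q i - (xs i - p i)) / (s i * (1 - xs i)).
  have := s0 i; have := xs1 i; rewrite /w /s => h1 h2.
  by field; rewrite !gt_eqF //; lra.
have sum1 : \sum_i q i ^+ 2 * w i <= 0.
  have -> : \sum_i q i ^+ 2 * w i =
      \sum_i q i ^+ 2 / s i - \sum_i q i ^+ 2 / (1 - xs i).
    by rewrite -sumrB; apply: eq_bigr => i _; rewrite mulrBr.
  rewrite subr_le0; apply: le_trans (ray q).
  rewrite big_distrr /=; apply: ler_sum => i _.
  rewrite ler_pdivrMr //; have := qsub i; rewrite -/(s i) => h.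
  have := ler_wpM2l (q0 i) h; nra.
have step2 i : 0 <= (q i ^+ 2 - (xs i - p i) ^+ 2) * w i ?= iff (q i == xs i - p i).
  split; last first.
    have [->|ne] := eqVneq (q i) (xs i - p i); first by rewrite subrr mul0r eqxx.
    apply/negbTE; rewrite eq_sym mulf_neq0 //.
      rewrite subr_sqr mulf_neq0 ?subr_eq0 //.
      have := q0 i; have := px i; rewrite addr_eq0 => h1 h2.
      by apply: contra ne => /eqP h; apply/eqP; lra.
    by rewrite wE mulf_neq0 ?subr_eq0 // invr_neq0 // mulf_neq0 ?gt_eqF.
  rewrite wE subr_sqr mulrA mulr_ge0 //.
    rewrite mulrAC -expr2 mulr_ge0 ?sqr_ge0 //.
    by rewrite addr_ge0 ?subr_ge0.
  by rewrite invr_ge0 ltW // mulr_gt0.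
pose f i := (1 - r i) ^+ 2 / r i.
pose T := \sum_i \sum_j A i j * xs i * xs j * (f i * (r j - r i)).
have step3 i : tau1 * \sum_j A i j * xs i * xs j * (f i * (r j - r i))
    <= (xs i - p i) ^+ 2 * w i.
  have h : tau1 * mxv A p i - r i * (tau1 * mxv A xs i) <= p i * w i.
    rewrite /w mulrBr lerB //.
      by rewrite ler_pdivlMr //; have := psup i; rewrite -/(s i); nra.
    rewrite [in leLHS](pE i) -mulrA ler_pM2l //.
    rewrite ler_pdivrMr // {1}(xsfix i); have := xs1 i; nra.
  have -> : (xs i - p i) ^+ 2 * w i = (f i * xs i) * (p i * w i).
    rewrite /f pE; move: (r0 i) (w i) => /gt_eqF ri wi; by field; rewrite ri.
  have -> : tau1 * (\sum_j A i j * xs i * xs j * (f i * (r j - r i))) =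
     (f i * xs i) * (tau1 * mxv A p i - r i * (tau1 * mxv A xs i)).
    rewrite /mxv mulrCA -mulrBr mulrCA; congr (_ * _).
    rewrite [r i * _]big_distrr -sumrB big_distrr /=; apply: eq_bigr => j _.
    by rewrite (pE j); ring.
  apply: ler_wpM2l h; apply: mulr_ge0; last exact: ltW.
  by rewrite /f divr_ge0 ?sqr_ge0 // ltW.
pose t i j := A i j * xs i * xs j * ((r j - r i) ^+ 2 * ((r i * r j)^-1 - 1)).
have T2 : T + T = \sum_i \sum_j t i j.
  rewrite {2}/T exchange_big /T -big_split /=; apply: eq_bigr => i _.
  rewrite -big_split /=; apply: eq_bigr => j _; rewrite (symA j i) /t /f.
  by field; rewrite !gt_eqF.
have t_ge0 i j : 0 <= t i j.
  rewrite /t mulr_ge0 //; first by rewrite !mulr_ge0 // ltW.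
  rewrite mulr_ge0 ?sqr_ge0 // subr_ge0.
  have rr0 : 0 < r i * r j by exact: mulr_gt0.
  by rewrite (invf_ge1 rr0); apply: mulr_ile1 => //; exact: ltW.
have T0 : 0 <= T.
  have : 0 <= T + T by rewrite T2; do 2!apply: sumr_ge0 => ? _.
  by lra.
have sum3 : tau1 * T <= \sum_i (xs i - p i) ^+ 2 * w i.
  by rewrite /T big_distrr /=; apply: ler_sum => i _.
have sum2 : 0 <= \sum_i (q i ^+ 2 - (xs i - p i) ^+ 2) * w i.
  by apply: sumr_ge0 => i _; case: (step2 i).
have split2 : \sum_i (q i ^+ 2 - (xs i - p i) ^+ 2) * w i =
    \sum_i q i ^+ 2 * w i - \sum_i (xs i - p i) ^+ 2 * w i.
  by rewrite -sumrB; apply: eq_bigr => i _; rewrite mulrBl.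
have t1T : 0 <= tau1 * T by rewrite mulr_ge0 // ltW.
split.
  have Teq0 : T = 0.
    have : tau1 * T = 0 by lra.
    by move/eqP; rewrite mulf_eq0 gt_eqF //= => /eqP.
  have tij i j : t i j = 0.
    have : \sum_i \sum_j t i j == 0 by rewrite -T2 Teq0 addr0.
    rewrite psumr_eq0 => [/allP /(_ i)|k _]; last by apply: sumr_ge0.
    rewrite mem_index_enum => /(_ isT) /=.
    rewrite psumr_eq0 => [/allP /(_ j)|k _]; last by apply: t_ge0.
    by rewrite mem_index_enum => /(_ isT)/eqP.
  move=> i j; apply: (connect_ind_rel (P := fun k => r i = r k) (conA i j)) => //.
  move=> k l -> Akl.
  have Axx : A k l * xs k * xs l != 0.
    by apply: mulf_neq0; [apply: mulf_neq0 => // |]; rewrite gt_eqF.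
  have /eqP := tij k l; rewrite /t mulf_eq0 (negbTE Axx) /= mulf_eq0 sqrf_eq0.
  rewrite !subr_eq0 => /orP[/eqP-> //|]; rewrite invr_eq1 => /eqP h.
  have := r1 k; have := r1 l; have := r0 k; have := r0 l; nra.
move=> i.
have : \sum_i (q i ^+ 2 - (xs i - p i) ^+ 2) * w i == 0.
  by rewrite eq_le sum2 andbT; lra.
rewrite psumr_eq0 => [/allP /(_ i)|k _]; last by case: (step2 k).
rewrite mem_index_enum => /(_ isT) /= /eqP h.
by case: (step2 i) => _; rewrite h eqxx => /esym/eqP.
Qed.

End Algebra.

Section Perron.
Variables (R : realType) (N : nat).
Implicit Types (A : 'M[R]_N) (s u v : 'I_N -> R).

Lemma continuous_sum (T : topologicalType) (I : finType) (f : I -> T -> R) :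
  (forall i, continuous (f i)) -> continuous (fun x => \sum_i f i x).
Proof.
move=> fcont x; apply: (cvg_big (U := R)); first exact: add_continuous.
by move=> i _; exact: fcont.
Qed.

Lemma mxv_coord_continuous A i :
  continuous (fun v : 'rV[R]_N => mxv A (v ord0) i).
Proof.
apply: continuous_sum => j v.
by apply: continuousM; [exact: cst_continuous | exact: coord_continuous].
Qed.

Lemma quadratic_ge0_eq0 (b c : R) :
  (forall t, 0 <= t * (2 * b) + t ^+ 2 * c) -> b = 0.
Proof.
move=> h; have k0 : 0 < `|c| + 1 by have := normr_ge0 c; lra.
have ck : c < `|c| + 1 by have := ler_norm c; lra.
move: (`|c| + 1) k0 ck => k k0 ck.
have : 0 <= k ^+ 2 * (- b / k * (2 * b) + (- b / k) ^+ 2 * c).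
  by apply: mulr_ge0; [rewrite exprn_ge0 // ltW | exact: h].
have -> : k ^+ 2 * (- b / k * (2 * b) + (- b / k) ^+ 2 * c) = b ^+ 2 * (c - 2 * k).
  by field; rewrite gt_eqF.
rewrite nmulr_lge0; last by lra.
by move=> b0; apply/eqP; rewrite -sqrf_eq0 eq_le b0 sqr_ge0.
Qed.

Lemma rayleigh_maximizer_eigen A s u mu :
  (forall i j, A i j = A j i) -> (forall i, 0 < s i) ->
  (forall v, \sum_i v i * mxv A v i <= mu * \sum_i v i ^+ 2 / s i) ->
  \sum_i u i * mxv A u i = mu * \sum_i u i ^+ 2 / s i ->
  forall i, s i * mxv A u i = mu * u i.
Proof.
move=> symA s0 ray ueq i.
suff /eqP : mu * u i / s i - mxv A u i = 0.
  by rewrite subr_eq0 => /eqP <-; field; rewrite gt_eqF.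
apply: (@quadratic_ge0_eq0 _ (mu / s i - A i i)) => t.
pose e j : R := (j == i)%:R.
have := ray (fun j => u j + t * e j).
have Ae k : mxv A (fun j => u j + t * e j) k = mxv A u k + t * A k i.
  rewrite /mxv.
  under eq_bigr do rewrite mulrDr.
  rewrite big_split /=; congr (_ + _); rewrite (bigD1 i) //= big1 => [|j ji].
    by rewrite /e eqxx mulr1 addr0 mulrC.
  by rewrite /e (negbTE ji) !mulr0.
have de (F : 'I_N -> R) : \sum_j e j * F j = F i.
  rewrite (bigD1 i) //= big1 => [|j ji]; first by rewrite /e eqxx mul1r addr0.
  by rewrite /e (negbTE ji) mul0r.
have -> : \sum_j (u j + t * e j) * mxv A (fun j0 => u j0 + t * e j0) j =
    \sum_j u j * mxv A u j + t * (2 * mxv A u i) + t ^+ 2 * A i i.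
  under eq_bigr do rewrite Ae.
  rewrite (eq_bigr (fun j => u j * mxv A u j + t * (A i j * u j)
     + t * (e j * mxv A u j) + t ^+ 2 * (e j * A j i))); last first.
    by move=> j _; rewrite (symA j i); ring.
  by rewrite !big_split /= -!big_distrr /= !de -/(mxv A u i); ring.
have -> : \sum_j (u j + t * e j) ^+ 2 / s j =
    \sum_j u j ^+ 2 / s j + t * (2 * (u i / s i)) + t ^+ 2 * (s i)^-1.
  rewrite (eq_bigr (fun j => u j ^+ 2 / s j + (2 * t) * (e j * (u j / s j))
     + t ^+ 2 * (e j * (e j / s j)))); last by move=> j _; ring.
  by rewrite !big_split /= -!big_distrr /= !de /e eqxx mul1r; ring.
by rewrite ueq !mulrDr -!addrA lerD2l -subr_ge0; congr (0 <= _); ring.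
Qed.

Lemma perron_frobenius_sym A s : (0 < N)%N ->
  (forall i j, 0 <= A i j) -> (forall i j, A i j = A j i) ->
  (forall i j, connect (fun k l => A k l != 0) i j) ->
  (forall i, 0 < s i) ->
  exists mu u, [/\ (forall i, 0 < u i), (forall i, s i * mxv A u i = mu * u i) &
    (forall v, \sum_i v i * mxv A v i <= mu * \sum_i v i ^+ 2 / s i)].
Proof.
move=> N0 A0 symA conA s0; pose i0 := Ordinal N0.
pose nrm (v : 'rV[R]_N) := \sum_i v ord0 i ^+ 2 / s i.
pose F (v : 'rV[R]_N) := \sum_i v ord0 i * mxv A (v ord0) i.
pose box := [set v : 'rV[R]_N | forall i, `[0, s i + 1]%classic (v ord0 i)].
have box_compact : compact box.
  apply: (@rV_compact _ _ (fun i => `[0, s i + 1]%classic)) => i.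
  exact: segment_compact.
have nrm_cont : continuous nrm.
  apply: continuous_sum => i v.
  apply: (@continuousM _ _ (fun v : 'rV[R]_N => v ord0 i ^+ 2) (fun=> (s i)^-1));
    last exact: cst_continuous.
  by apply: (@continuousM _ _ (fun v : 'rV[R]_N => v ord0 i)
    (fun v : 'rV[R]_N => v ord0 i)); exact: coord_continuous.
have F_cont : continuous F.
  apply: continuous_sum => i v.
  by apply: continuousM; [exact: coord_continuous | exact: mxv_coord_continuous].
pose K := box `&` nrm @^-1` [set 1].
have K_compact : compact K.
  apply: compact_closedI => //; apply: preimage_closed => [v _|].
    exact: nrm_cont.
  exact: accessible_closed_set1 (hausdorff_accessible (@Rhausdorff R)) _.
have normalize (v : 'I_N -> R) : (forall i, 0 <= v i) -> \sum_i v i ^+ 2 / s i = 1 ->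
    K (\row_i v i).
  move=> v0 v1; split => /=; last by rewrite -v1; apply: eq_bigr => i _; rewrite mxE.
  move=> i; rewrite /= in_itv /= mxE v0 /=.
  have : v i ^+ 2 / s i <= 1.
    rewrite -v1 (bigD1 i) //= lerDl; apply: sumr_ge0 => j _.
    by rewrite divr_ge0 ?sqr_ge0 // ltW.
  by rewrite ler_pdivrMr // mul1r; have := v0 i; have := s0 i; nra.
have FE v : F (\row_i v i) = \sum_i v i * mxv A v i.
  apply: eq_bigr => i _; rewrite mxE; congr (_ * _).
  by apply: eq_bigr => j _; rewrite mxE.
have K0 : K !=set0.
  exists (\row_i (if i == i0 then Num.sqrt (s i) else 0)); apply: normalize.
    by move=> i; case: ifP => //; rewrite sqrtr_ge0.
  rewrite (bigD1 i0) //= ?eqxx sqr_sqrtr ?(ltW (s0 _)) // divff ?gt_eqF //.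
  by rewrite big1 ?addr0 // => i /negbTE->; rewrite expr0n mul0r.
have [c] := @EVT_max_rV R N F K K0 K_compact (continuous_subspaceT F_cont).
rewrite inE => -[cbox cnrm] cmax.
pose mu := F c; pose u i := c ord0 i.
have u0 i : 0 <= u i by have := cbox i; rewrite /= in_itv /= => /andP[].
have ray v : \sum_i v i * mxv A v i <= mu * \sum_i v i ^+ 2 / s i.
  pose n := \sum_i v i ^+ 2 / s i.
  have n0 : 0 <= n.
    by apply: sumr_ge0 => i _; rewrite divr_ge0 ?sqr_ge0 // ltW.
  have [nz|nz] := eqVneq n 0.
    have vz i : v i = 0.
      move/eqP: nz; rewrite /n psumr_eq0 => [/allP /(_ i)|j _]; last first.
        by rewrite divr_ge0 ?sqr_ge0 // ltW.
      rewrite mem_index_enum => /(_ isT).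
      by rewrite mulf_eq0 invr_eq0 (gt_eqF (s0 i)) orbF sqrf_eq0 => /eqP.
    rewrite -/n nz mulr0 big1 // => i _; by rewrite vz mul0r.
  have np : 0 < n by rewrite lt_def nz.
  pose k := (Num.sqrt n)^-1.
  have k2 : k ^+ 2 = n^-1 by rewrite /k exprVn sqr_sqrtr.
  have k0 : 0 <= k by rewrite invr_ge0 sqrtr_ge0.
  pose a i := k * `|v i|.
  have Ka : K (\row_i a i).
    apply: normalize => [i|]; first by rewrite mulr_ge0.
    rewrite (eq_bigr (fun i => k ^+ 2 * (v i ^+ 2 / s i))); last first.
      by move=> i _; rewrite /a exprMn real_normK ?num_real //; ring.
    by rewrite -big_distrr /= k2 -/n mulVf.
  have := cmax _ (mem_set Ka); rewrite FE -/mu => Fa.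
  rewrite -/n -ler_pdivrMr // mulrC -k2; apply: le_trans Fa.
  rewrite big_distrr /=; apply: ler_sum => i _; rewrite /a mxvZ.
  have -> : k * `|v i| * (k * mxv A (fun j => `|v j|) i) =
     k ^+ 2 * (`|v i| * mxv A (fun j => `|v j|) i) by ring.
  apply: ler_wpM2l; first by rewrite exprn_ge0.
  apply: (le_trans (ler_norm _)); rewrite normrM; apply: ler_wpM2l => //.
  apply: (le_trans (ler_norm_sum _ _ _)); apply: ler_sum => j _.
  by rewrite normrM (ger0_norm (A0 i j)).
have ueq i : s i * mxv A u i = mu * u i.
  apply: rayleigh_maximizer_eigen => //.
  by have -> : \sum_i u i ^+ 2 / s i = 1 by []; rewrite mulr1.
exists mu, u; split => // i; rewrite lt_def u0 andbT; apply/eqP => ui.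
have uz j : u j = 0.
  apply: (connect_ind_rel (P := fun k => u k = 0) (conA i j)) => // k l uk Akl.
  apply: (@mxv_eq0 _ _ A u k l) => //.
  by have := ueq k; rewrite uk mulr0 => /eqP; rewrite mulf_eq0 gt_eqF //= => /eqP->.
move: cnrm; rewrite /= /nrm big1 => [/esym/eqP|j _]; first by rewrite oner_eq0.
by rewrite -/(u j) uz expr0n mul0r.
Qed.

Lemma diagv_mulE s A i j : (diagv s *m A) i j = s i * A i j.
Proof. by rewrite /diagv mul_diag_mx mxE mxE. Qed.

Lemma lambda_max_perron A s u mu : (0 < N)%N ->
  (forall i j, 0 <= A i j) -> (forall i j, A i j = A j i) ->
  (forall i, 0 < s i) -> (forall i, 0 < u i) ->
  (forall i, s i * mxv A u i = mu * u i) ->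
  lambda_max (diagv s *m A) = mu.
Proof.
move=> N0 A0 symA s0 u0 ueq; rewrite /lambda_max.
set E := [set _ | _ in _].
have eigP z : eigenvalues (diagv s *m A) z =
   eigenvalue (map_mx (real_complex R) (diagv s *m A)) z :> Prop.
  by rewrite /eigenvalues /= -eigenvalue_root_char.
have Emu : E mu.
  exists (real_complex R mu) => //; rewrite eigP eigenvalue_map.
  apply/eigenvalueP; exists (\row_i (u i / s i)).
    apply/rowP => j; rewrite !mxE; transitivity (mxv A u j).
      apply: eq_bigr => i _; rewrite diagv_mulE mxE (symA j i).
      by field; rewrite gt_eqF.
    by rewrite mulrA -ueq; field; rewrite gt_eqF.
  apply/negP => /eqP/rowP/(_ (Ordinal N0)); rewrite !mxE => /eqP.
  by rewrite mulf_eq0 invr_eq0 !gt_eqF.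
have Eub : ubound E mu.
  move=> _ [z + <-]; rewrite eigP => /eigenvalueP[w wz wn0].
  pose a i := complex.Re `|w ord0 i|.
  pose m := complex.Re `|z|.
  have nE (x : R[i]) : `|x| = real_complex R (complex.Re `|x|).
    by apply/esym/RRe_real/normr_real.
  have a0 i : 0 <= a i by rewrite -lecR -nE normr_ge0.
  have am : complex.Re z <= m.
    apply: (le_trans (ler_norm _)).
    by rewrite -lecR /m -nE normc_ge_Re.
  apply: (le_trans am).
  have aineq j : m * a j <= \sum_i a i * (s i * A i j).
    have aE i : (a i)%:C%C = `|w ord0 i| by rewrite [RHS]nE.
    have mE : m%:C%C = `|z| by rewrite [RHS]nE.
    rewrite -lecR rmorphM /= mE aE -normrM.
    have := congr1 (fun M : 'rV_N => M ord0 j) wz; rewrite !mxE => <-.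
    apply: (le_trans (ler_norm_sum _ _ _)); rewrite rmorph_sum /=.
    apply: ler_sum => i _; rewrite normrM mxE diagv_mulE [leRHS]rmorphM /= aE.
    have sA : 0 <= s i * A i j by rewrite mulr_ge0 // ltW.
    by apply: ler_wpM2l => //; rewrite ger0_norm // ler0c.
  have : m * \sum_j a j * u j <= mu * \sum_j a j * u j.
    have -> : mu * (\sum_j a j * u j) = \sum_j \sum_i a i * (s i * A i j) * u j.
      rewrite exchange_big big_distrr /=; apply: eq_bigr => i _.
      rewrite mulrCA -ueq /mxv !big_distrr /=.
      by apply: eq_bigr => j _; ring.
    rewrite big_distrr /=; apply: ler_sum => j _.
    rewrite -big_distrl /= mulrA; apply: ler_wpM2r; first exact: ltW.
    exact: aineq.
  rewrite ler_pM2r //.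
  have au0 i : 0 <= a i * u i by rewrite mulr_ge0 // ltW.
  rewrite lt_def sumr_ge0 // andbT psumr_eq0 //; apply/negP => /allP h.
  case/negP: wn0; apply/eqP/rowP => i; rewrite !mxE.
  have := h i (mem_index_enum _); rewrite /= mulf_eq0 (gt_eqF (u0 i)) orbF => /eqP ai.
  by apply/eqP; rewrite -normr_eq0 nE -/(a i) ai.
apply/eqP; rewrite eq_le; apply/andP; split.
  by apply: ge_sup => //; exists mu.
by apply: ub_le_sup => //; exists mu.
Qed.

Lemma lambda_max_spec A s : (0 < N)%N -> adjacency_connected A ->
  (forall i, 0 < s i) ->
  (exists2 u : 'I_N -> R, (forall i, 0 < u i) &
     (forall i, s i * mxv A u i = lambda_max (diagv s *m A) * u i)) /\
  (forall v, \sum_i v i * mxv A v i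
     <= lambda_max (diagv s *m A) * \sum_i v i ^+ 2 / s i).
Proof.
move=> N0 [A01 symA _ conA] s0.
have A0 i j : 0 <= A i j by case: (A01 i j) => ->; rewrite ?ler01.
have [mu [u [u0 ueq ray]]] := perron_frobenius_sym N0 A0 symA conA s0.
rewrite (lambda_max_perron N0 A0 symA s0 u0 ueq); split => //; by exists u.
Qed.

End Perron.

Section Barrier.
Variable R : realType.
Implicit Types (t d e c : R).

Lemma is_derive_gt0_left (g : R -> R) t d e :
  is_derive t 1 g d -> 0 < d -> 0 < e -> exists2 s, t - e < s < t & g s < g t.
Proof.
move=> [gd gE] d0 e0.
have : h^-1 *: (g (h *: 1 + t) - g t) @[h --> 0^'] --> d by rewrite -gE.
move=> /cvgr_gt /(_ _ d0) /nbhs_ballP[r /= r0 rP].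
pose h := - (Num.min r e / 2).
have m0 : 0 < Num.min r e by rewrite lt_min r0.
have h0 : h < 0 by rewrite /h; lra.
have mr : Num.min r e <= r by rewrite ge_min lexx.
have me : Num.min r e <= e by rewrite ge_min lexx orbT.
exists (h *: 1 + t); first by rewrite /h [_ *: 1]mulr1; lra.
have := rP h; rewrite /ball /= sub0r normrN ltr0_norm // lt_eqF //.
move=> /(_ _ isT); rewrite /h opprK => /(_ ltac:(lra)).
by rewrite -/h [_ *: (_ - _)]/( _ * _) nmulr_rgt0 ?invr_lt0 // subr_lt0.
Qed.

Lemma barrier (I : finType) (g : I -> R -> R) (T0 T1 : R) :
  (forall i, continuous (g i)) -> (forall i, 0 < g i T0) ->
  (forall i t, T0 < t <= T1 -> (forall j, 0 <= g j t) -> g i t = 0 ->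
     exists2 d, 0 < d & is_derive t 1 (g i) d) ->
  forall i t, T0 <= t <= T1 -> 0 < g i t.
Proof.
move=> gcont g0 gd i1 t1 t1T; rewrite ltNge; apply/negP => gt1.
pose E := [set t | T0 <= t <= T1 /\ exists i, g i t <= 0].
have Et1 : E t1 by split => //; exists i1.
have Elb : has_lbound E by exists T0 => t [/andP[]].
have Einf : has_inf E by split => //; exists t1.
pose m := inf E.
have mE t : E t -> m <= t by move=> Et; exact: ge_inf.
have T0m : T0 <= m by apply: lb_le_inf => [|t [/andP[]]//]; exists t1.
have mT1 : m <= T1 by apply: le_trans (mE _ Et1) _; case/andP: t1T.
have before s j : T0 <= s -> s < m -> 0 < g j s.
  move=> Ts sm; rewrite ltNge; apply/negP => gs.
  have : E s by split; [rewrite Ts; lra | exists j].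
  by move/mE; lra.
have [i gim] : exists i, g i m <= 0.
  apply: contrapT => /forallNP gm.
  have : \forall s \near m, forall i, 0 < g i s.
    apply: (filter_forall (nbhs_filter m)) => i.
    by apply: (cvgr_gt _ (gcont i m) 0); rewrite ltNge; apply/negP/gm.
  move=> /nbhs_ballP[r /= r0 rP].
  have [s Es sm] := inf_adherent r0 Einf.
  have ms := mE _ Es; case: Es => _ [i gis].
  have := rP s; rewrite /ball /= distrC ger0_norm; last by rewrite -/m; lra.
  by move=> /(_ ltac:(rewrite -/m in sm *; lra) i); lra.
have T0lt : T0 < m.
  rewrite lt_def T0m andbT; apply/eqP => mT.
  by have := g0 i; rewrite -mT; lra.
have gm0 j : 0 <= g j m.
  rewrite leNgt; apply/negP => gjm.
  have : \forall s \near m, g j s < 0 by exact: (cvgr_lt _ (gcont j m)).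
  move=> /nbhs_ballP[r /= r0 rP].
  pose k := Num.min (r / 2) (m - T0).
  have k0 : 0 < k by rewrite lt_min; apply/andP; split; lra.
  have kr : k <= r / 2 by rewrite ge_min lexx.
  have km : k <= m - T0 by rewrite ge_min lexx orbT.
  have := rP (m - k); rewrite /ball /= opprB addrCA subrr addr0 gtr0_norm //.
  by move=> /(_ ltac:(lra)); have := before (m - k) j ltac:(lra) ltac:(lra); lra.
have gi0 : g i m = 0 by apply/eqP; rewrite eq_le gim gm0.
have [d d0 dg] := gd i m ltac:(rewrite T0lt; lra) gm0 gi0.
have [s /andP[s1 s2]] := is_derive_gt0_left dg d0 (e := m - T0) ltac:(lra).
by rewrite gi0; have := before s i ltac:(lra) s2; lra.
Qed.

Lemma barrier1 (g : R -> R) (T0 : R) :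
  continuous g -> 0 < g T0 ->
  (forall t, T0 < t -> g t = 0 -> exists2 d, 0 < d & is_derive t 1 g d) ->
  forall t, T0 <= t -> 0 < g t.
Proof.
move=> gcont g0 gd t T0t.
apply: (@barrier unit (fun _ => g) T0 t) => //; last by rewrite T0t lexx.
by move=> _ s /andP[Ts _] _; exact: gd.
Qed.

Lemma is_derive_affine (a b t : R) : is_derive t 1 (fun s => a + b * s) b.
Proof.
have h : is_derive t 1 (fun s : R => b * s) b.
  by apply: is_derive_eq; rewrite ?scaler0 ?addr0 [_ *: _]mulr1.
exact: is_derive_eq (is_deriveD (is_derive_cst a t 1) h) (add0r b).
Qed.

Lemma continuous_affine (a b : R) : continuous (fun s : R => a + b * s).
Proof.
move=> s; apply: (@continuousD _ _ _ (fun=> a)); first exact: cst_continuous.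
by apply: (@continuousM _ _ (fun=> b)); [exact: cst_continuous | exact: cvg_id].
Qed.

Lemma is_derive_addexp (f : R -> R) t d (c k : R) : is_derive t 1 f d ->
  is_derive t 1 (fun s => f s + c * expR (k * s)) (d + c * (k * expR (k * t))).
Proof.
move=> fd.
have h1 : is_derive t 1 (fun s : R => k * s) k.
  by apply: is_derive_eq; rewrite ?scaler0 ?addr0 [_ *: _]mulr1.
have h2 : is_derive t 1 (expR \o (fun s : R => k * s)) (expR (k * t) * k).
  by apply: is_derive1_comp.
have h3 : is_derive t 1 (c \*: (expR \o (fun s : R => k * s)))
    (c *: (expR (k * t) * k)).
  exact: is_deriveZ.
by apply: is_derive_eq (is_deriveD fd h3) _; rewrite [k * expR _]mulrC.
Qed.

Lemma continuous_addexp (f : R -> R) (c k : R) : continuous f ->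
  continuous (fun s => f s + c * expR (k * s)).
Proof.
move=> fc s; apply: (@continuousD _ _ _ f); first exact: fc.
apply: (@continuousM _ _ (fun=> c)); first exact: cst_continuous.
apply: (@continuous_comp _ _ _ (fun s => k * s) expR); last exact: continuous_expR.
by apply: (@continuousM _ _ (fun=> k)); [exact: cst_continuous | exact: cvg_id].
Qed.

Lemma eventually_le_of_drift (f df : R -> R) (c eta m T : R) :
  continuous f -> 0 < eta ->
  (forall t, T < t -> is_derive t 1 f (df t)) ->
  (forall t, T < t -> m <= f t) ->
  (forall t, T < t -> c < f t -> df t <= - eta) ->
  \forall t \near +oo, f t <= c.
Proof.
move=> fc eta0 fd fm drift.
have [t0 Tt0 ft0] : exists2 t0, T < t0 & f t0 <= c.
  apply: contrapT => no.
  have fgt t : T < t -> c < f t.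
    by move=> Tt; rewrite ltNge; apply/negP => h; apply: no; exists t.
  pose t1 := T + 1; pose a := f t1 + 1 + eta / 2 * t1.
  pose g s := (a + - (eta / 2) * s) - f s.
  have gpos t : t1 <= t -> 0 < g t.
    apply: barrier1.
    - move=> s; apply: (@continuousB _ _ _ (fun s => a + - (eta / 2) * s)).
        exact: continuous_affine.
      exact: fc.
    - by rewrite /g /a; lra.
    - move=> s ts _; have Ts : T < s by rewrite /t1 in ts; lra.
      exists (- (eta / 2) - df s); last first.
        exact: is_deriveB (is_derive_affine _ _ _) (fd _ Ts).
      by have := drift s Ts (fgt _ Ts); lra.
  pose t := Num.max t1 ((a - m) / (eta / 2)).
  have t1t : t1 <= t by rewrite le_max lexx.
  have : (a - m) / (eta / 2) <= t by rewrite le_max lexx orbT.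
  rewrite ler_pdivrMr; last by lra.
  have := gpos t t1t; rewrite /g.
  have := fm t ltac:(rewrite /t1 in t1t; lra); lra.
exists t0; split; first exact: num_real.
move=> t t0t; apply/ler_addgt0Pr => e e0; apply: ltW; rewrite -subr_gt0.
pose g s := (c + e) - f s.
apply: (@barrier1 g t0); last exact: ltW.
- move=> s; apply: (@continuousB _ _ _ (fun=> c + e)); last exact: fc.
  exact: cst_continuous.
- by rewrite /g; lra.
- move=> s t0s gs; have Ts : T < s by lra.
  exists (0 - df s); last exact: is_deriveB (is_derive_cst _ _ _) (fd _ Ts).
  by have := drift s Ts ltac:(rewrite /g in gs; lra); lra.
Qed.

Lemma continuous_bounded_itv (I : finType) (f : I -> R -> R) (a b : R) :
  a <= b -> (forall i, continuous (f i)) ->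
  exists2 M, 1 <= M & forall i t, a <= t <= b -> `|f i t| <= M.
Proof.
move=> ab fc; pose F t := \sum_i `|f i t|.
have Fc : continuous F.
  apply: continuous_sum => i t.
  apply: (@continuous_comp _ _ _ (f i) Num.norm); first exact: fc.
  exact: norm_continuous.
have [c _ cmax] := EVT_max ab (continuous_subspaceT Fc).
exists (F c + 1); first by rewrite lerDr sumr_ge0.
move=> i t tab; apply: (@le_trans _ _ (F t)).
  by rewrite /F (bigD1 i) //= lerDl sumr_ge0.
by apply: (le_trans (cmax t _)); rewrite ?in_itv // lerDl.
Qed.

Lemma small_quadratic (a0 a1 a2 b : R) : a0 < 0 -> 0 < b ->
  exists e, [/\ 0 < e, e <= b & a0 + a1 * e + a2 * e ^+ 2 < 0].
Proof.
move=> a00 b0; pose k := `|a1| + `|a2| + 1.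
have n1 := ler_norm a1; have n2 := ler_norm a2.
have m1 := normr_ge0 a1; have m2 := normr_ge0 a2.
have k0 : 0 < k by rewrite /k; lra.
pose e := Num.min (Num.min b 1) (- a0 / (2 * k)).
have e0 : 0 < e by rewrite !lt_min b0 ltr01 /= divr_gt0 //; lra.
have eb : e <= b by rewrite !ge_min lexx.
have e1 : e <= 1 by rewrite !ge_min lexx !orbT.
have : e <= - a0 / (2 * k) by rewrite !ge_min lexx !orbT.
rewrite ler_pdivlMr; last by lra.
rewrite /k => ek; exists e; split => //.
have : a1 * e <= `|a1| * e by rewrite ler_pM2r.
have : a2 * e ^+ 2 <= `|a2| * e ^+ 2 by rewrite ler_pM2r // exprn_gt0.
have : `|a2| * e ^+ 2 <= `|a2| * e.
  by apply: ler_wpM2l => //; rewrite expr2 ler_piMl // ltW.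
by nra.
Qed.

Lemma finite_pos_lower_bound (I : finType) (f : I -> R) : (forall i, 0 < f i) ->
  exists2 e, 0 < e & forall i, e <= f i.
Proof.
move=> f0.
have : \forall e \near 0^'+, 0 < e /\ forall i, e <= f i.
  apply: filterI; first exact: nbhs_right_gt.
  by apply: (filter_forall (at_right_proper_filter 0)) => i; exact: nbhs_right_le.
by move=> /filter_ex[e [e0 ef]]; exists e.
Qed.

End Barrier.

Section EventualBounds.
Variable R : realType.
Implicit Types (f : R -> R) (c e : R).

Definition eventual_sup f : R := inf [set c | \forall t \near +oo, f t <= c].
Definition eventual_inf f : R := - eventual_sup (fun t => - f t).

Lemma eventual_sup_has_inf f : (forall t, 0 <= t -> -1 <= f t <= 1) ->
  has_inf [set c | \forall t \near +oo, f t <= c].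
Proof.
move=> fb; split.
  exists 1; exists 0; split => // t /ltW /fb/andP[].
  by [].
exists (-1) => c [M [_ MP]].
have := MP (Num.max M 0 + 1); have := fb (Num.max M 0 + 1).
have m1 : M <= Num.max M 0 by rewrite le_max lexx.
have m2 : 0 <= Num.max M 0 by rewrite le_max lexx orbT.
by move=> /(_ ltac:(lra))/andP[h1 h2] /(_ ltac:(lra)); lra.
Qed.

Lemma eventual_sup_le f c : (forall t, 0 <= t -> -1 <= f t <= 1) ->
  (\forall t \near +oo, f t <= c) -> eventual_sup f <= c.
Proof. by move=> /eventual_sup_has_inf[_ lb] h; apply: ge_inf. Qed.

Lemma eventual_sup_near f e : (forall t, 0 <= t -> -1 <= f t <= 1) -> 0 < e ->
  \forall t \near +oo, f t <= eventual_sup f + e.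
Proof.
move=> /eventual_sup_has_inf hinf e0; have [c /= cP ce] := inf_adherent e0 hinf.
by apply: filterS cP => t /le_trans; apply; exact: ltW.
Qed.

Lemma eventual_inf_ge f c : (forall t, 0 <= t -> -1 <= f t <= 1) ->
  (\forall t \near +oo, c <= f t) -> c <= eventual_inf f.
Proof.
move=> fb h; rewrite lerNr; apply: eventual_sup_le => [t /fb|]; first by lra.
by apply: filterS h => t; rewrite lerN2.
Qed.

Lemma eventual_inf_near f e : (forall t, 0 <= t -> -1 <= f t <= 1) -> 0 < e ->
  \forall t \near +oo, eventual_inf f - e <= f t.
Proof.
move=> fb e0.
have : \forall t \near +oo, - f t <= eventual_sup (fun t => - f t) + e.
  by apply: eventual_sup_near => // t /fb; lra.
by apply: filterS => t; rewrite /eventual_inf; lra.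
Qed.

Lemma near_pinfty_after (P : R -> Prop) : (\forall t \near +oo, P t) ->
  exists2 T, 0 <= T & forall t, T < t -> P t.
Proof.
move=> [M [_ MP]]; exists (Num.max M 0); first by rewrite le_max lexx orbT.
by move=> t; rewrite gt_max => /andP[Mt _]; exact: MP.
Qed.

Lemma eventual_inf_le_sup f : (forall t, 0 <= t -> -1 <= f t <= 1) ->
  eventual_inf f <= eventual_sup f.
Proof.
move=> fb; apply/ler_addgt0Pr => e e0.
have e2 : 0 < e / 2 by lra.
have [T _ TP] := near_pinfty_after
  (filterI (eventual_inf_near fb e2) (eventual_sup_near fb e2)).
by have [] := TP (T + 1) ltac:(lra); lra.
Qed.

Lemma eventual_bounds_cvg f l : (forall t, 0 <= t -> -1 <= f t <= 1) ->
  l <= eventual_inf f -> eventual_sup f <= l -> f @ +oo --> l.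
Proof.
move=> fb lf fl; apply/cvgrPdist_le => e e0.
have [T _ TP] := near_pinfty_after
  (filterI (eventual_inf_near fb e0) (eventual_sup_near fb e0)).
exists T; split => [|t /TP[h1 h2]]; first exact: num_real.
by rewrite ler_distlC; apply/andP; split; lra.
Qed.

End EventualBounds.

Section Trajectories.
Variables (R : realType) (N : nat).
Implicit Types (A B : 'M[R]_N) (x y : R -> 'I_N -> R) (u h : 'I_N -> R).

(* Continuity is required on all of R, but nothing else at negative times, so
   that no one-sided continuity at 0 has to be carried along. *)
Definition extended_traj (beta1 delta1 beta2 delta2 : R) A B x y : Prop :=
  [/\ (forall i, continuous (fun t => x t i)), (forall i, continuous (fun t => y t i)),
      (forall (i : 'I_N) (t : R), 0 < t ->
         is_derive t (1 : R) (fun s => x s i)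
           (bivirus_fx beta1 delta1 A (x t) (y t) i)) &
      (forall (i : 'I_N) (t : R), 0 < t ->
         is_derive t (1 : R) (fun s => y s i)
           (bivirus_fy beta2 delta2 B (x t) (y t) i))].

Lemma extended_traj_sym beta1 delta1 beta2 delta2 A B x y :
  extended_traj beta1 delta1 beta2 delta2 A B x y ->
  extended_traj beta2 delta2 beta1 delta1 B A y x.
Proof.
case=> cx cy dx dy; split => // i t t0.
- apply: is_derive_eq (dy i t t0) _; rewrite /bivirus_fy /bivirus_fx.
  by rewrite -!addrA [- x t i - _]addrC.
- apply: is_derive_eq (dx i t t0) _; rewrite /bivirus_fy /bivirus_fx.
  by rewrite -!addrA [- x t i - _]addrC.
Qed.

Lemma in_D_sym (v w : 'I_N -> R) : in_D v w -> in_D w v.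
Proof. by move=> D i; have [? ? ?] := D i; split => //; rewrite addrC. Qed.

Lemma mxv0 A i : mxv A (fun=> 0) i = 0.
Proof. by rewrite /mxv big1 // => j _; rewrite mulr0. Qed.

Lemma mxv_ge_opp A v e i : (forall i j, 0 <= A i j <= 1) -> 0 <= e ->
  (forall j, - e <= v j) -> - (N%:R * e) <= mxv A v i.
Proof.
move=> A01 e0 ve; have : mxv A (fun=> 0) i <= mxv A v i + N%:R * e.
  by apply: mxv_le_shift => // j; have := ve j; lra.
by rewrite mxv0; lra.
Qed.

Lemma mxv_le_cst A v M i : (forall i j, 0 <= A i j <= 1) -> 0 <= M ->
  (forall j, v j <= M) -> mxv A v i <= N%:R * M.
Proof.
move=> A01 M0 vM; have : mxv A v i <= mxv A (fun=> 0) i + N%:R * M.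
  by apply: mxv_le_shift => // j; have := vM j; lra.
by rewrite mxv0; lra.
Qed.

Lemma in_D_invariant beta1 delta1 beta2 delta2 A B x y :
  (forall i j, 0 <= A i j <= 1) -> (forall i j, 0 <= B i j <= 1) ->
  0 < beta1 -> 0 < delta1 -> 0 < beta2 -> 0 < delta2 ->
  extended_traj beta1 delta1 beta2 delta2 A B x y -> in_D (x 0) (y 0) ->
  forall t : R, 0 <= t -> in_D (x t) (y t).
Proof.
move=> A01 B01 b1 d1 b2 d2 [cx cy dx dy] D0 T T0.
pose f (k : 'I_N + 'I_N) t := match k with inl i => x t i | inr i => y t i end.
have [|M M1 fM] := @continuous_bounded_itv _ _ f 0 T T0.
  by case=> i; [exact: cx | exact: cy].
have xM t i : 0 <= t <= T -> - M <= x t i <= M.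
  by move=> tT; rewrite -ler_norml; exact: (fM (inl i)).
have yM t i : 0 <= t <= T -> - M <= y t i <= M.
  by move=> tT; rewrite -ler_norml; exact: (fM (inr i)).
pose n := N%:R : R.
have n0 : 0 <= n by exact: ler0n.
pose K := 4 * n * M * (beta1 + beta2) + delta1 + delta2 + 1.
pose g e (k : 'I_N + ('I_N + 'I_N)) s := match k with
  | inl i => x s i + e * expR (K * s)
  | inr (inl i) => y s i + e * expR (K * s)
  | inr (inr i) => (1 - x s i - y s i) + e * expR (K * s) end.
have prod_ge (z a E : R) : 0 < E -> - E <= z -> z <= 3 * M -> - (n * E) <= a ->
    a <= n * M -> - (4 * n * M * E) <= z * a.
  move=> E0 zE zM aE aM.
  have nE : 0 <= n * E by rewrite mulr_ge0 // ltW.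
  have nME : 0 <= n * M * E by rewrite !mulr_ge0 //; lra.
  have [z0|z0] := leP 0 z.
    have : z * (- (n * E)) <= z * a by exact: ler_wpM2l.
    have : z * (n * E) <= 3 * M * (n * E) by exact: ler_wpM2r.
    by lra.
  have [a0|a0] := leP 0 a.
    have : (- E) * a <= z * a by exact: ler_wpM2r.
    have : E * a <= E * (n * M) by apply: ler_wpM2l => //; exact: ltW.
    by lra.
  have : 0 <= z * a by rewrite nmulr_rge0 // ltW.
  by lra.
have key e : 0 < e -> forall k t, 0 <= t <= T -> 0 < g e k t.
  move=> e0; apply: barrier.
  - case=> [i|[i|i]]; apply: continuous_addexp; [exact: cx | exact: cy |].
    move=> s; apply: (@continuousB _ _ _ (fun s => 1 - x s i)); last exact: cy.
    apply: (@continuousB _ _ _ (fun=> 1 : R) (x^~ i)); last exact: cx.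
    exact: cst_continuous.
  - by case=> [i|[i|i]]; have [/andP[? ?] /andP[? ?] ?] := D0 i;
      rewrite /g mulr0 expR0; lra.
  move=> k t /andP[t0 tT] gpos.
  pose E := e * expR (K * t).
  have E0 : 0 < E by rewrite mulr_gt0 // expR_gt0.
  have t0T : 0 <= t <= T by rewrite tT andbT ltW.
  have xE j : - E <= x t j by have := gpos (inl j); rewrite /g -/E; lra.
  have yE j : - E <= y t j by have := gpos (inr (inl j)); rewrite /g -/E; lra.
  have zE j : - E <= 1 - x t j - y t j.
    by have := gpos (inr (inr j)); rewrite /g -/E; lra.
  have zM j : 1 - x t j - y t j <= 3 * M.
    by have := xM t j t0T; have := yM t j t0T; lra.
  have AxE j : - (n * E) <= mxv A (x t) j by apply: mxv_ge_opp => //; exact: ltW.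
  have ByE j : - (n * E) <= mxv B (y t) j by apply: mxv_ge_opp => //; exact: ltW.
  have M0 : 0 <= M by lra.
  have AxM j : mxv A (x t) j <= n * M.
    by apply: mxv_le_cst => // k'; have /andP[] := xM t k' t0T.
  have ByM j : mxv B (y t) j <= n * M.
    by apply: mxv_le_cst => // k'; have /andP[] := yM t k' t0T.
  have AxMl j : - (n * M) <= mxv A (x t) j.
    by apply: mxv_ge_opp => // k'; have /andP[] := xM t k' t0T.
  have ByMl j : - (n * M) <= mxv B (y t) j.
    by apply: mxv_ge_opp => // k'; have /andP[] := yM t k' t0T.
  have KE : e * (K * expR (K * t)) = K * E by rewrite /E mulrCA.
  have nM0 : 0 <= n * M by rewrite mulr_ge0.
  case: k => [i|[i|i]]; rewrite /g -/E => gi.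
  - exists (bivirus_fx beta1 delta1 A (x t) (y t) i + e * (K * expR (K * t)));
      last exact/is_derive_addexp/dx.
    rewrite KE /bivirus_fx.
    have xi : x t i = - E by lra.
    have := ler_wpM2l (ltW b1) (prod_ge _ _ _ E0 (zE i) (zM i) (AxE i) (AxM i)).
    have : 0 <= n * M * beta2 * E by rewrite !mulr_ge0 // ltW.
    have : 0 < delta1 * E by rewrite mulr_gt0.
    have : 0 < delta2 * E by rewrite mulr_gt0.
    by rewrite [X in _ - delta1 * X]xi /K; lra.
  - exists (bivirus_fy beta2 delta2 B (x t) (y t) i + e * (K * expR (K * t)));
      last exact/is_derive_addexp/dy.
    rewrite KE /bivirus_fy.
    have yi : y t i = - E by lra.
    have := ler_wpM2l (ltW b2) (prod_ge _ _ _ E0 (zE i) (zM i) (ByE i) (ByM i)).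
    have : 0 <= n * M * beta1 * E by rewrite !mulr_ge0 // ltW.
    have : 0 < delta1 * E by rewrite mulr_gt0.
    have : 0 < delta2 * E by rewrite mulr_gt0.
    by rewrite [X in _ - delta2 * X]yi /K; lra.
  - exists (0 - bivirus_fx beta1 delta1 A (x t) (y t) i
       - bivirus_fy beta2 delta2 B (x t) (y t) i + e * (K * expR (K * t)));
      last first.
      apply: is_derive_addexp; apply: is_deriveB (dy i t t0).
      exact: is_deriveB (is_derive_cst _ _ _) (dx i t t0).
    rewrite KE /bivirus_fx /bivirus_fy.
    have -> : 1 - x t i - y t i = - E by lra.
    have bE1 : 0 <= beta1 * E by rewrite mulr_ge0 // ltW.
    have bE2 : 0 <= beta2 * E by rewrite mulr_ge0 // ltW.
    have := ler_wpM2l bE1 (AxMl i); have := ler_wpM2l bE2 (ByMl i).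
    have := ler_wpM2l (ltW d1) (xE i); have := ler_wpM2l (ltW d2) (yE i).
    have : 0 <= n * M * beta1 * E by rewrite !mulr_ge0 // ltW.
    have : 0 <= n * M * beta2 * E by rewrite !mulr_ge0 // ltW.
    by rewrite /K; lra.
have nonneg (a : R) : (forall e, 0 < e -> 0 < a + e * expR (K * T)) -> 0 <= a.
  move=> h; apply/ler_addgt0Pr => e e0.
  have := h (e / expR (K * T)); rewrite divr_gt0 ?expR_gt0 // => /(_ isT).
  by rewrite divfK ?gt_eqF ?expR_gt0 // => /ltW.
have TT : 0 <= T <= T by rewrite T0 lexx.
move=> i.
have x0 : 0 <= x T i by apply: nonneg => e e0; exact: (key e e0 (inl i) T TT).
have y0 : 0 <= y T i by apply: nonneg => e e0; exact: (key e e0 (inr (inl i)) T TT).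
have z0 : 0 <= 1 - x T i - y T i.
  by apply: nonneg => e e0; exact: (key e e0 (inr (inr i)) T TT).
by split; lra.
Qed.

Section InvariantTrajectory.
Variables (beta1 delta1 beta2 delta2 : R) (A B : 'M[R]_N) (x y : R -> 'I_N -> R).
Hypothesis A01 : forall i j, 0 <= A i j <= 1.
Hypotheses (b1 : 0 < beta1) (d1 : 0 < delta1) (d2 : 0 < delta2).
Hypothesis traj : extended_traj beta1 delta1 beta2 delta2 A B x y.
Hypothesis D : forall t : R, 0 <= t -> in_D (x t) (y t).

Let A0 i j : 0 <= A i j. Proof. by have /andP[] := A01 i j. Qed.

Let x_ge0 (t : R) i : 0 <= t -> 0 <= x t i.
Proof. by move=> /D /(_ i)[/andP[]]. Qed.

Let z_ge0 (t : R) i : 0 <= t -> 0 <= 1 - x t i - y t i.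
Proof. by move=> /D /(_ i)[_ _]; lra. Qed.

Let Ax_ge0 (t : R) i : 0 <= t -> 0 <= mxv A (x t) i.
Proof. by move=> t0; apply: mxv_ge0 => // j; exact: x_ge0. Qed.

Let x_bounded i (t : R) : 0 <= t -> -1 <= x t i <= 1.
Proof. by move=> /D /(_ i)[]; lra. Qed.

Lemma traj_strictly_pos : (forall i j, A i j = A j i) ->
  (forall i j, connect (fun k l => A k l != 0) i j) -> vgt0 (x 0) ->
  forall (t : R) i, 0 < t -> 0 < x t i.
Proof.
case: traj => cx cy dx dy symA conA [x0 [i0 x0i0]] t i t0.
apply: (connect_ind_rel (P := fun k => forall t : R, 0 < t -> 0 < x t k)
  (conA i0 i)) => //.
  move=> {}t {}t0; pose c := x 0 i0 / 2.
  have c0 : 0 < c by rewrite divr_gt0 // lt_def x0i0 x0.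
  pose g s := x s i0 + (- c) * expR (- (delta1 + 1) * s).
  suff : 0 < g t.
    have := mulr_gt0 c0 (expR_gt0 (- (delta1 + 1) * t)).
    by rewrite /g; lra.
  apply: (@barrier1 _ g 0); last exact: ltW.
  - exact: continuous_addexp.
  - by rewrite /g mulr0 expR0 /c; rewrite /c in c0; lra.
  move=> s s0 gs.
  exists (bivirus_fx beta1 delta1 A (x s) (y s) i0
     + (- c) * (- (delta1 + 1) * expR (- (delta1 + 1) * s)));
    last exact/is_derive_addexp/dx.
  rewrite /bivirus_fx.
  have := mulr_ge0 (mulr_ge0 (ltW b1) (z_ge0 i0 (ltW s0))) (Ax_ge0 i0 (ltW s0)).
  have := mulr_gt0 c0 (expR_gt0 (- (delta1 + 1) * s)).
  move: gs; rewrite /g; move: (expR _) => E gs cE h.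
  have xE : x s i0 = c * E by lra.
  by rewrite [X in _ - _ * X]xE; lra.
move=> k l xk Akl s s0; rewrite lt_def x_ge0 ?andbT; last exact: ltW.
apply/eqP => xl.
have Axl : 0 < mxv A (x s) l.
  rewrite ltNge; apply/negP => h.
  have := mxv_eq0 (j := k) A0 (fun j => x_ge0 j (ltW s0)) h.
  by rewrite symA => /(_ Akl) xk0; have := xk s s0; rewrite xk0 ltxx.
have dxl := dx l s s0.
have yl : y s l = 1.
  apply/eqP; rewrite eq_le; have [_ /andP[_ ->] _] /= := D (ltW s0) l.
  rewrite leNgt; apply/negP => yl1.
  have pos : 0 < bivirus_fx beta1 delta1 A (x s) (y s) l.
    by rewrite /bivirus_fx xl mulr0 subr0 subr0 !mulr_gt0 // subr_gt0.
  have [r /andP[r1 r2]] := is_derive_gt0_left dxl pos s0.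
  by rewrite xl ltNge x_ge0 //; lra.
have dyl := is_deriveB (is_derive_cst (1 : R) s 1) (dy l s s0).
have pos : 0 < 0 - bivirus_fy beta2 delta2 B (x s) (y s) l.
  by rewrite /bivirus_fy xl yl subr0 subrr mulr0 mul0r mulr1 !sub0r opprK.
have [r /andP[r1 r2] ylt] := is_derive_gt0_left dyl pos s0.
have {}ylt : 1 - y r l < 1 - y s l := ylt.
by have [_ /andP[_ yr] _] := D (t := r) ltac:(lra) l; lra.
Qed.

Lemma eventual_sup_subsolution (l : 'I_N -> R) :
  (forall e i, 0 < e -> \forall t \near +oo, l i - e <= y t i) ->
  forall i, delta1 * eventual_sup (x^~ i) <=
    beta1 * (1 - eventual_sup (x^~ i) - l i) *
      mxv A (fun j => eventual_sup (x^~ j)) i.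
Proof.
case: traj => cx cy dx dy yl i.
pose p j := eventual_sup (x^~ j); rewrite -/(p i) -/p leNgt; apply/negP => lt.
pose s := 1 - p i - l i; pose a := mxv A p i; pose n := N%:R : R.
have [e [e0 _ eP]] := @small_quadratic R (beta1 * s * a - delta1 * p i)
  (beta1 * (2 * a + s * n) + delta1) (beta1 * 2 * n) 1
  ltac:(rewrite /s /a; lra) ltr01.
have [T T0 TP] := near_pinfty_after (filterI (yl e i e0)
  (filter_forall _ (fun j => eventual_sup_near (@x_bounded j) e0))).
have : \forall t \near +oo, x t i <= p i - e.
  pose eta := - (beta1 * (s + 2 * e) * (a + n * e) - delta1 * (p i - e)).
  apply: (@eventually_le_of_drift _ (x^~ i)
    (fun t => bivirus_fx beta1 delta1 A (x t) (y t) i) _ eta 0 T).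
  - exact: cx.
  - by rewrite /eta; lra.
  - by move=> t Tt; apply: dx; lra.
  - by move=> t Tt; apply: x_ge0; lra.
  move=> t Tt pt; have [yt xt] := TP t Tt.
  have t0 : 0 <= t by lra.
  have Axn : mxv A (x t) i <= a + n * e by apply: mxv_le_shift => //; exact: ltW.
  have z1 : 1 - x t i - y t i <= s + 2 * e by rewrite /s; lra.
  have z0 := z_ge0 i t0; have Ax0 := Ax_ge0 i t0.
  have : (1 - x t i - y t i) * mxv A (x t) i <= (s + 2 * e) * (a + n * e).
    exact: ler_pM.
  move/(ler_wpM2l (ltW b1)); have := ler_wpM2l (ltW d1) (ltW pt).
  by rewrite /bivirus_fx /eta; lra.
by move/(eventual_sup_le (@x_bounded i)); rewrite -/(p i); lra.
Qed.

Lemma eventual_inf_supersolution h :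
  (forall e i, 0 < e -> \forall t \near +oo, y t i <= h i + e) ->
  forall i, beta1 * (1 - eventual_inf (x^~ i) - h i) *
      mxv A (fun j => eventual_inf (x^~ j)) i <= delta1 * eventual_inf (x^~ i).
Proof.
case: traj => cx cy dx dy yh i.
pose p j := eventual_inf (x^~ j); rewrite -/(p i) -/p leNgt; apply/negP => lt.
have p0 j : 0 <= p j.
  apply: eventual_inf_ge; first exact: x_bounded.
  by exists 0; split => // t t0; apply: x_ge0; exact: ltW.
pose s := 1 - p i - h i; pose a := mxv A p i; pose n := N%:R : R.
have a0 : 0 <= a by exact: mxv_ge0.
have s0 : 0 < s.
  rewrite ltNge; apply/negP => s0.
  have := mulr_ge0 (ltW d1) (p0 i).
  have : beta1 * s * a <= 0.
    by apply: mulr_le0_ge0 => //; apply: mulr_ge0_le0 => //; exact: ltW.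
  by rewrite /s /a; lra.
have [e [e0 es eP]] := @small_quadratic R (delta1 * p i - beta1 * s * a)
  (beta1 * (2 * a + s * n) + delta1) (- (beta1 * 2 * n)) (s / 2)
  ltac:(rewrite /s /a; lra) ltac:(lra).
have [T T0 TP] := near_pinfty_after (filterI (yh e i e0)
  (filter_forall _ (fun j => eventual_inf_near (@x_bounded j) e0))).
have : \forall t \near +oo, - x t i <= - (p i + e).
  pose eta := beta1 * (s - 2 * e) * (a - n * e) - delta1 * (p i + e).
  apply: (@eventually_le_of_drift _ (fun t => - x t i)
    (fun t => - bivirus_fx beta1 delta1 A (x t) (y t) i) _ eta (-1) T).
  - by move=> t; apply: continuousN; exact: cx.
  - by rewrite /eta; lra.
  - by move=> t Tt; apply: is_deriveN; apply: dx; lra.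
  - by move=> t Tt; have := x_bounded i (_ : 0 <= t); lra.
  move=> t Tt pt; have [yt xt] := TP t Tt.
  have t0 : 0 <= t by lra.
  have Axn : a <= mxv A (x t) i + n * e.
    apply: mxv_le_shift => //; first exact: ltW.
    by move=> j; have := xt j; rewrite -/(p j); lra.
  have z1 : s - 2 * e <= 1 - x t i - y t i by rewrite /s; lra.
  have Ax0 := Ax_ge0 i t0.
  have h1 := ler_wpM2r Ax0 z1.
  have h2 : (s - 2 * e) * (a - n * e) <= (s - 2 * e) * mxv A (x t) i.
    by apply: ler_wpM2l; lra.
  have := ler_wpM2l (ltW b1) (le_trans h2 h1).
  have := ler_wpM2l (ltW d1) (ltW pt).
  by rewrite /bivirus_fx /eta; lra.
move=> near_x; have : p i + e <= p i; last by lra.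
apply: eventual_inf_ge; first exact: x_bounded.
by apply: filterS near_x => t; rewrite lerN2.
Qed.

Lemma traj_persistent u h :
  (forall i, 0 < u i) -> (forall i, delta1 * u i < beta1 * (1 - h i) * mxv A u i) ->
  (forall e i, 0 < e -> \forall t \near +oo, y t i <= h i + e) ->
  (forall (t : R) i, 0 < t -> 0 < x t i) ->
  exists2 c, 0 < c & forall i, \forall t \near +oo, c * u i <= x t i.
Proof.
case: traj => cx cy dx dy u0 uP yh xpos.
have Au0 i : 0 <= mxv A u i by apply: mxv_ge0 => // j; exact: ltW.
have /choice[f fP] i : exists e, 0 < e /\
    delta1 * u i < beta1 * (1 - h i - 2 * e) * mxv A u i.
  have [e [e0 _ eP]] := @small_quadratic R
    (delta1 * u i - beta1 * (1 - h i) * mxv A u i) (beta1 * 2 * mxv A u i) 0 1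
    ltac:(have := uP i; lra) ltr01.
  by exists e; split => //; lra.
have [e e0 ef] := finite_pos_lower_bound (fun i => proj1 (fP i)).
have [T T0 TP] := near_pinfty_after (filter_forall _ (fun j => yh e j e0)).
pose t0 := T + 1; have t00 : 0 < t0 by rewrite /t0; lra.
have [c c0 cP] := @finite_pos_lower_bound R _
  (fun i => Num.min (e / u i) (x t0 i / (2 * u i)))
  ltac:(by move=> i; rewrite lt_min !divr_gt0 ?mulr_gt0 ?xpos //; lra).
have ce i : c * u i <= e.
  by have := cP i; rewrite le_min => /andP[+ _]; rewrite ler_pdivlMr.
have cx0 i : c * u i < x t0 i.
  have := cP i; rewrite le_min => /andP[_]; rewrite ler_pdivlMr ?mulr_gt0 //.
  by have := mulr_gt0 c0 (u0 i); lra.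
exists c => // i; exists t0; split; first exact: num_real.
move=> t t0t; rewrite -subr_ge0; apply: ltW.
apply: (@barrier _ _ (fun i s => x s i - c * u i) t0 t); last by rewrite lexx ltW.
- move=> j s; apply: (@continuousB _ _ _ (x^~ j)); first exact: cx.
  exact: cst_continuous.
- by move=> j; rewrite subr_gt0.
move=> j s /andP[t0s _] xs0 xj; have s0 : 0 < s by lra.
exists (bivirus_fx beta1 delta1 A (x s) (y s) j - 0); last first.
  exact: is_deriveB (dx j s s0) (is_derive_cst _ _ _).
have xE : x s j = c * u j by lra.
have Axc : c * mxv A u j <= mxv A (x s) j.
  by rewrite -mxvZ; apply: le_mxv => // k; rewrite -subr_ge0.
have ys : y s j <= h j + e by apply: TP; rewrite /t0 in t0s; lra.
have z1 : 1 - h j - 2 * f j <= 1 - x s j - y s j.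
  by have := ce j; have := ef j; lra.
have h1 := ler_wpM2l (z_ge0 j (ltW s0)) Axc.
have h2 := ler_wpM2r (mulr_ge0 (ltW c0) (Au0 j)) z1.
have := ler_wpM2l (ltW b1) (le_trans h2 h1).
have [_] := fP j; rewrite -(ltr_pM2l c0).
by rewrite /bivirus_fx [X in _ - _ * X - 0]xE; lra.
Qed.

End InvariantTrajectory.
End Trajectories.

Section Exclusion.
Variables (R : realType) (N : nat).
Implicit Types (A B : 'M[R]_N) (x y : R -> 'I_N -> R) (xs ys : 'I_N -> R).

Lemma bivirus_traj_extend beta1 delta1 beta2 delta2 A B x y (x0 y0 : 'I_N -> R) :
  bivirus_traj beta1 delta1 beta2 delta2 A B x y x0 y0 ->
  extended_traj beta1 delta1 beta2 delta2 A B (fun t => x `|t|) (fun t => y `|t|).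
Proof.
case=> _ cx cy dx dy.
have ext_cont (f : R -> R) : {within [set t : R | 0 <= t], continuous f} ->
    continuous (fun t : R => f `|t|).
  move=> /subspace_continuousP fc t.
  apply: (@cvg_comp _ _ _ (fun t : R => `|t|) f (nbhs t)
    (within [set t : R | 0 <= t] (nbhs `|t|))); last exact: fc (normr_ge0 _).
  move=> P /= hP.
  have hn : nbhs t [set s : R | 0 <= `|s| -> P `|s|] by exact: norm_continuous hP.
  change (nbhs t [set s : R | P `|s|]).
  by apply: filterS hn => s /(_ (normr_ge0 s)).
have ext_eq (f : R -> R) (t : R) : 0 < t -> \forall s \near t, f s = f `|s|.
  move=> t0; have : \forall s \near t, 0 < s by exact: lt_nbhsr.
  by apply: filterS => s s0; rewrite gtr0_norm.
split => [i|i|i t t0|i t t0].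
- exact: ext_cont (cx i).
- exact: ext_cont (cy i).
- rewrite /= (gtr0_norm t0).
  exact: (@near_eq_is_derive _ _ _ (x^~ i)) (ext_eq _ _ t0) (dx i t t0).
- rewrite /= (gtr0_norm t0).
  exact: (@near_eq_is_derive _ _ _ (y^~ i)) (ext_eq _ _ t0) (dy i t t0).
Qed.

Lemma adjacency01 A : adjacency_connected A -> forall i j, 0 <= A i j <= 1.
Proof. by case=> + _ _ _ i j => /(_ i j)[]->; rewrite lexx ler01. Qed.

Lemma rayleigh_bound A beta delta (s : 'I_N -> R) : (0 < N)%N ->
  adjacency_connected A -> 0 < beta -> 0 < delta -> (forall i, 0 < s i) ->
  beta / delta * lambda_max (diagv s *m A) <= 1 ->
  forall v, beta / delta * \sum_i v i * mxv A v i <= \sum_i v i ^+ 2 / s i.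
Proof.
move=> N0 adjA b0 d0 s0 le1 v.
have [_ ray] := lambda_max_spec N0 adjA s0.
have t0 : 0 <= beta / delta by rewrite divr_ge0 // ltW.
apply: (le_trans (ler_wpM2l t0 (ray v))); rewrite mulrA ler_piMl //.
by apply: sumr_ge0 => i _; rewrite divr_ge0 ?sqr_ge0 // ltW.
Qed.

Lemma rayleigh_bound1 A beta delta : (0 < N)%N ->
  adjacency_connected A -> 0 < beta -> 0 < delta ->
  beta / delta * lambda_max A <= 1 ->
  forall v, beta / delta * \sum_i v i * mxv A v i <= \sum_i v i ^+ 2.
Proof.
move=> N0 adjA b0 d0 le1 v.
have diag1 : diagv (fun=> 1) *m A = A.
  by apply/matrixP => i j; rewrite diagv_mulE mul1r.
rewrite -diag1 in le1.
have := rayleigh_bound N0 adjA b0 d0 (s := fun=> 1) (fun=> ltr01) le1 v.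
by under [leRHS]eq_bigr do rewrite divr1.
Qed.

Lemma sis_field_fixed A beta delta z i : 0 < delta ->
  sis_field beta delta A z i = 0 -> z i = beta / delta * (1 - z i) * mxv A z i.
Proof.
rewrite /sis_field => d0 h.
have -> : beta / delta * (1 - z i) * mxv A z i =
   (beta * (1 - z i) * mxv A z i) / delta by field; rewrite gt_eqF.
by rewrite (_ : beta * _ * _ = delta * z i); [field; rewrite gt_eqF | lra].
Qed.

Lemma sis_attractor_bounds A beta delta z :
  sis_attractor beta delta A z -> forall i, 0 <= z i < 1.
Proof.
rewrite /sis_attractor; case: ifP => _ => [z0 i|[z01 _] i].
  by rewrite z0 lexx ltr01.
by have /andP[/ltW -> ->] := z01 i.
Qed.

Lemma sis_subsolution_le_attractor A beta delta z p : (0 < N)%N ->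
  adjacency_connected A -> 0 < beta -> 0 < delta ->
  sis_attractor beta delta A z ->
  (forall i, 0 <= p i) -> (forall i, p i <= beta / delta * (1 - p i) * mxv A p i) ->
  forall i, p i <= z i.
Proof.
move=> N0 adjA b0 d0 att p0 psub i.
have A0 k l : 0 <= A k l by have /andP[] := adjacency01 adjA k l.
have t0 : 0 < beta / delta by rewrite divr_gt0.
move: att; rewrite /sis_attractor; case: ifP => [le1 z0|_ [z01 zfix]].
  rewrite z0 (sis_subsolution_eq0 A0 t0 _ p0 psub) //.
  exact: rayleigh_bound1.
apply: (sis_subsolution_le A0 t0 _ _ p0 psub) => k; first by have /andP[] := z01 k.
exact: sis_field_fixed.
Qed.

Lemma competitive_exclusion beta1 delta1 beta2 delta2 A B xs ys x y :
  (0 < N)%N -> adjacency_connected A -> adjacency_connected B ->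
  0 < beta1 -> 0 < delta1 -> 0 < beta2 -> 0 < delta2 ->
  sis_attractor beta1 delta1 A xs -> sis_attractor beta2 delta2 B ys ->
  (beta1 / delta1) * lambda_max (diagv (fun i => 1 - ys i) *m A) > 1 ->
  (beta2 / delta2) * lambda_max (diagv (fun i => 1 - xs i) *m B) <= 1 ->
  extended_traj beta1 delta1 beta2 delta2 A B x y ->
  in_D (x 0) (y 0) -> vgt0 (x 0) ->
  conv_to x xs /\ conv_to y (fun _ => 0).
Proof.
move=> N0 adjA adjB b1 d1 b2 d2 attx atty gt1 le1 traj D0 x0.
have A01 := adjacency01 adjA; have B01 := adjacency01 adjB.
have A0 k l : 0 <= A k l by have /andP[] := A01 k l.
have B0 k l : 0 <= B k l by have /andP[] := B01 k l.
have symA : forall i j, A i j = A j i by case: adjA.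
have conA : forall i j, connect (fun k l => A k l != 0) i j by case: adjA.
have t1 : 0 < beta1 / delta1 by rewrite divr_gt0.
have t2 : 0 < beta2 / delta2 by rewrite divr_gt0.
have ysb := sis_attractor_bounds atty.
have ys1 i : 0 < 1 - ys i by rewrite subr_gt0; case/andP: (ysb i).
have xs1 i : 0 < 1 - xs i.
  by rewrite subr_gt0; case/andP: (sis_attractor_bounds attx i).
have ray := rayleigh_bound N0 adjB b2 d2 xs1 le1.
have traj' := extended_traj_sym traj.
have D := in_D_invariant A01 B01 b1 d1 b2 d2 traj D0.
have D' t (t0 : 0 <= t) := in_D_sym (D t t0).
have [[u u0 ueq] _] := lambda_max_spec N0 adjA ys1.
have uP i : u i < beta1 / delta1 * (1 - ys i) * mxv A u i.
  by rewrite -mulrA ueq mulrA ltr_pMl.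
move=> {gt1 le1 ueq}.
have [xs01 xsfix] : (forall i, 0 < xs i < 1) /\
    (forall i, xs i = beta1 / delta1 * (1 - xs i) * mxv A xs i).
  move: attx; rewrite /sis_attractor; case: ifP => [leA _|_ [h1 h2]]; last first.
    by split => // i; exact: sis_field_fixed.
  have := rayleigh_bound1 N0 adjA b1 d1 leA u; rewrite leNgt => /negP[].
  rewrite big_distrr /=; apply: ltr_sum => [|i _].
    by apply/hasP; exists (Ordinal N0); rewrite ?mem_index_enum.
  rewrite expr2 mulrCA ltr_pM2l //; apply: (lt_le_trans (uP i)).
  have Au0 : 0 <= mxv A u i by apply: mxv_ge0 => // j; exact: ltW.
  have := mulr_ge0 (mulr_ge0 (ltW t1) Au0) (_ : 0 <= ys i).
  by have /andP[-> _] := ysb i => /(_ isT); lra.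
have xs0 i : 0 < xs i by have /andP[] := xs01 i.
have xb i (t : R) : 0 <= t -> -1 <= x t i <= 1 by move=> /D /(_ i)[]; lra.
have yb i (t : R) : 0 <= t -> -1 <= y t i <= 1 by move=> /D /(_ i)[]; lra.
pose px i := eventual_sup (x^~ i).
pose p i := eventual_inf (x^~ i).
pose q i := eventual_sup (y^~ i).
have p_ge0 i : 0 <= p i.
  apply: eventual_inf_ge; first exact: xb.
  by exists 0; split => // t /ltW /D /(_ i)[/andP[]].
have ppx i : p i <= px i by exact: eventual_inf_le_sup (xb i).
have q_ge0 i : 0 <= q i.
  apply: le_trans (eventual_inf_le_sup (yb i)).
  apply: eventual_inf_ge; first exact: yb.
  by exists 0; split => // t /ltW /D /(_ i)[_ /andP[]].
have divd (b d a c : R) : 0 < d -> d * a <= b * c -> a <= b / d * c.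
  by move=> d0 h; rewrite mulrAC ler_pdivlMr // mulrC.
have px_xs i : px i <= xs i.
  apply: (sis_subsolution_le_attractor N0 adjA b1 d1 attx) => [j|j].
    exact: le_trans (p_ge0 j) (ppx j).
  have := eventual_sup_subsolution A01 b1 d1 traj D (l := fun=> 0).
  move=> /(_ _ j); rewrite subr0 -mulrA => h; rewrite -mulrA; apply: divd => //.
  apply: h => e k e0; exists 0; split => // t /ltW /D /(_ k)[_ /andP[+ _] _]; lra.
have q_ys i : q i <= ys i.
  apply: (sis_subsolution_le_attractor N0 adjB b2 d2 atty) => // j.
  have := eventual_sup_subsolution B01 b2 d2 traj' D' (l := fun=> 0).
  move=> /(_ _ j); rewrite subr0 -mulrA => h; rewrite -mulrA; apply: divd => //.
  apply: h => e k e0; exists 0; split => // t /ltW /D /(_ k)[/andP[+ _] _ _]; lra.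
have xpos := traj_strictly_pos A01 b1 d2 traj D symA conA x0.
have p_gt0 i : 0 < p i.
  have [|||c c0 cP] := traj_persistent A01 b1 traj D u0 (h := ys).
  - move=> j; have := uP j; rewrite -(ltr_pM2l d1); congr (_ < _).
    by field; rewrite gt_eqF.
  - move=> e j e0; apply: filterS (eventual_sup_near (yb j) e0) => t.
    by have := q_ys j; rewrite -/(q j); lra.
  - exact: xpos.
  apply: (@lt_le_trans _ _ (c * u i)); first by rewrite mulr_gt0.
  by apply: eventual_inf_ge => //; exact: xb.
have p_xs i : 0 < p i <= xs i by rewrite p_gt0 (le_trans (ppx i)).
have psup i : beta1 / delta1 * (1 - p i - q i) * mxv A p i <= p i.
  have := eventual_inf_supersolution A01 b1 d1 traj D (h := q) _ i.
  move=> /(_ (fun e j => eventual_sup_near (yb j) (e := e))).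
  rewrite -/(p i) -/p => h; rewrite !(mulrAC _ delta1^-1) ler_pdivrMr //.
  by rewrite [leRHS]mulrC.
have qsub i : q i <= beta2 / delta2 * (1 - p i - q i) * mxv B q i.
  have := eventual_sup_subsolution B01 b2 d2 traj' D' (l := p) _ i.
  move=> /(_ (fun e j => eventual_inf_near (xb j) (e := e))).
  rewrite -/(q i) -/q addrAC => h; rewrite !(mulrAC _ delta2^-1) ler_pdivlMr //.
  by rewrite [leLHS]mulrC.
have [rE qE] := coexistence_rigidity A0 B0 symA conA t1 t2 xs01 xsfix ray
  p_xs q_ge0 psup qsub.
have p_eq i : p i = xs i.
  apply/eqP; rewrite eq_le; have /andP[_ -> /=] := p_xs i.
  rewrite leNgt; apply/negP => pi.
  pose c := p i / xs i.
  have c1 : 0 < 1 - c by rewrite subr_gt0 ltr_pdivrMr // mul1r.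
  have qc j : q j = (1 - c) * xs j.
    rewrite qE /c (rE i j); field; by rewrite gt_eqF.
  have xsub j : xs j <= beta2 / delta2 * (1 - xs j) * mxv B xs j.
    have := qsub j; rewrite {1}qc qE.
    have -> : mxv B q j = (1 - c) * mxv B xs j.
      by rewrite -mxvZ; apply: eq_bigr => k _; rewrite qc.
    rewrite [leRHS]mulrCA ler_pM2l // => /le_trans; apply.
    by rewrite (_ : 1 - p j - (xs j - p j) = 1 - xs j) //; ring.
  have xy j : xs j <= ys j.
    by apply: (sis_subsolution_le_attractor N0 adjB b2 d2 atty) => // k; exact: ltW.
  have : \sum_j xs j * u j / (1 - xs j) < \sum_j xs j * u j / (1 - xs j);
    last by rewrite ltxx.
  have {2}-> : \sum_j xs j * u j / (1 - xs j) =
      \sum_j xs j * (beta1 / delta1 * mxv A u j).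
    transitivity (beta1 / delta1 * \sum_j u j * mxv A xs j).
      rewrite big_distrr /=; apply: eq_bigr => j _; rewrite {1}xsfix.
      by field; rewrite !gt_eqF.
    rewrite (mxv_sym _ _ symA) big_distrr /=; apply: eq_bigr => j _.
    by rewrite mulrCA.
  apply: ltr_sum => [|j _].
    by apply/hasP; exists (Ordinal N0); rewrite ?mem_index_enum.
  rewrite -mulrA ltr_pM2l // ltr_pdivrMr //; apply: (lt_le_trans (uP j)).
  have Au0 : 0 <= mxv A u j by apply: mxv_ge0 => // k; exact: ltW.
  rewrite [leRHS]mulrAC; apply: ler_wpM2r => //.
  by apply: ler_wpM2l; [exact: ltW | have := xy j; lra].
split=> i; apply: eventual_bounds_cvg => //.
- exact: xb.
- by rewrite -/(p i) p_eq.
- exact: px_xs.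
- exact: yb.
- apply: eventual_inf_ge; first exact: yb.
  by exists 0; split => // t /ltW /D /(_ i)[_ /andP[]].
- by rewrite -/(q i) qE p_eq subrr.
Qed.

Lemma conv_to_extend x (z : 'I_N -> R) : conv_to (fun t => x `|t|) z -> conv_to x z.
Proof.
move=> h i; apply: cvg_trans (h i); apply: near_eq_cvg.
by exists 0; split => // t t0; rewrite gtr0_norm.
Qed.

End Exclusion.

Theorem theorem3 (R : realType) (N : nat) (A B : 'M[R]_N)
  (beta1 delta1 beta2 delta2 : R) (xs ys : 'I_N -> R) :
  (0 < N)%N ->
  adjacency_connected A -> adjacency_connected B ->
  0 < beta1 -> 0 < delta1 -> 0 < beta2 -> 0 < delta2 ->
  sis_attractor beta1 delta1 A xs ->
  sis_attractor beta2 delta2 B ys ->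
  (* (i) *)
  ((beta1 / delta1) * lambda_max (diagv (fun i => 1 - ys i) *m A) > 1 ->
   (beta2 / delta2) * lambda_max (diagv (fun i => 1 - xs i) *m B) <= 1 ->
   forall (x0 y0 : 'I_N -> R) (x y : R -> 'I_N -> R),
     in_D x0 y0 -> vgt0 x0 ->
     bivirus_traj beta1 delta1 beta2 delta2 A B x y x0 y0 ->
     conv_to x xs /\ conv_to y (fun _ => 0))
  /\
  (* (ii) *)
  ((beta1 / delta1) * lambda_max (diagv (fun i => 1 - ys i) *m A) <= 1 ->
   (beta2 / delta2) * lambda_max (diagv (fun i => 1 - xs i) *m B) > 1 ->
   forall (x0 y0 : 'I_N -> R) (x y : R -> 'I_N -> R),
     in_D x0 y0 -> vgt0 y0 ->
     bivirus_traj beta1 delta1 beta2 delta2 A B x y x0 y0 ->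
     conv_to x (fun _ => 0) /\ conv_to y ys).
Proof.
move=> N0 adjA adjB b1 d1 b2 d2 attx atty; split=> h1 h2 x0 y0 x y D0 v0 traj.
- have [[ex ey] _ _ _ _] := traj.
  have ext := bivirus_traj_extend traj.
  have [||cx cy] := competitive_exclusion N0 adjA adjB b1 d1 b2 d2 attx atty h1 h2 ext.
  + by rewrite /= normr0 ex ey.
  + by rewrite /= normr0 ex.
  by split; exact: conv_to_extend.
- have [[ex ey] _ _ _ _] := traj.
  have ext := extended_traj_sym (bivirus_traj_extend traj).
  have [||cy cx] := competitive_exclusion N0 adjB adjA b2 d2 b1 d1 atty attx h2 h1 ext.
  + by rewrite /= normr0 ex ey; exact: in_D_sym.
  + by rewrite /= normr0 ey.
  by split; exact: conv_to_extend.
Qed.
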